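(* Let $G$ be an independence group and let $n$ be a nonnegative integer. Suppose $A,B$ are subsets of $G$, both of rank $n$. Let $\mathcal{A}$ be a basis of $A$. Then $\mathcal{A}$ is matchable, relative to $A$, to every basis of $B$ if and only if, for every $J \subseteq \mathcal{A}$, $$\rho\left(\bigcap_{a \in J} (a^{-1}A \cap B)\right) \leq n - |J|,$$ where the intersection is understood to equal $B$ when $J$ is empty.
   Context: A finitary matroid is a pair $(E,\mathcal{I})$ consisting of a set $E$ and a nonempty collection $\mathcal{I}$ of subsets of $E$ (called the independent sets) such that: (I1) if $A\in\mathcal{I}$ and $B\subseteq A$ then $B\in\mathcal{I}$; (I2) if $A,B$ are finite elements of $\mathcal{I}$ with $|B|=|A|+1$, then there is $x\in B\setminus A$ with $\{x\}\cup A\in\mathcal{I}$; (I3) if $A\subseteq E$ and every finite subset of $A$ belongs to $\mathcal{I}$, then $A\in\mathcal{I}$. The collection $\mathcal{I}$ is called an independence structure on $E$. A basis of a subset $A\subseteq E$ is an independent subset of $A$ that is maximal under inclusion among independent subsets of $A$; bases exist and any two bases of $A$ have the same cardinality, and the rank $\rho(A)$ is that cardinal number. An independence group is a group $G$ (written multiplicatively) together with an independence structure $\mathcal{I}$ on the set $G$ such that for every $g\in G$ and $A\subseteq G$ one has $gA\in\mathcal{I}$ if and only if $A\in\mathcal{I}$, where $gA=\{gx:x\in A\}$. Let $A$ be a finite-rank subset of an independence group $G$, $\mathcal{A}$ a basis of $A$, and $\mathcal{B}$ an independent subset of $G$. We say $\mathcal{A}$ is matchable to $\mathcal{B}$ relative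 to $A$ if there exists a bijection $f:\mathcal{A}\to\mathcal{B}$ such that $af(a)\notin A$ for all $a\in\mathcal{A}$. *)

(* Defs.v *)
From mathcomp Require Import all_boot finmap.
From mathcomp Require Import boolp classical_sets functions cardinality.

Set Implicit Arguments.
Unset Strict Implicit.
Unset Printing Implicit Defensive.

Local Open Scope classical_set_scope.
Local Open Scope card_scope.

(* The ground set is a whole type [T]; [I] is the collection of independent
   sets.  [X #= `I_k] states that [X] is finite with exactly [k] elements. *)
Record finitary_matroid (T : Type) (I : set (set T)) : Prop := FinitaryMatroid {
  indep_nonempty : I !=set0;
  indep_sub : forall A B, I A -> B `<=` A -> I B;
  indep_augment : forall (k : nat) A B, I A -> I B ->
    A #= `I_k -> B #= `I_k.+1 ->
    exists2 x, (B `\` A) x & I ([set x] `|` A);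
  indep_finitary : forall A,
    (forall F, finite_set F -> F `<=` A -> I F) -> I A
}.

Record basis (T : Type) (I : set (set T)) (A X : set T) : Prop := Basis {
  basis_indep : I X;
  basis_sub : X `<=` A;
  basis_max : forall Y, I Y -> Y `<=` A -> X `<=` Y -> Y = X
}.

(* [has_rank I A n] states that the rank of [A] is the finite cardinal [n].
   It is a relation since the rank is a cardinal, possibly infinite; see
   [basis_exists], [basis_card] and [has_rank_inj] below for the fact that it
   does not depend on the basis. *)
Definition has_rank (T : Type) (I : set (set T)) (A : set T) (n : nat) : Prop :=
  exists2 X, basis I A X & X #= `I_n.

Definition ltranslate (G : groupType) (g : G) (A : set G) : set G :=
  [set (g * x)%g | x in A].

Record independence_group (G : groupType) (I : set (set G)) : Prop :=
  IndependenceGroup {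
    indgroup_matroid : finitary_matroid I;
    indgroup_transl : forall (g : G) (A : set G),
      I (ltranslate g A) <-> I A
  }.

(* Meant for a basis [X] of [A] and an independent set [Y].  Only the values
   of [f] on [X] matter. *)
Definition matchable (G : groupType) (A X Y : set G) : Prop :=
  exists2 f : G -> G, set_bij X Y f & forall a, X a -> ~ A (a * f a)%g.

Lemma basis_exists (T : choiceType) (I : set (set T))
    (matI : finitary_matroid I) (A : set T) : exists X, basis I A X.
Proof.
have [X0 IX0] := indep_nonempty matI.
have I0 : I set0 by apply: (indep_sub matI IX0).
pose P := [set X | I X /\ X `<=` A].
have chainP (C : set (set T)) : C `<=` P -> total_on C subset ->
    P (\bigcup_(X in C) X).
  move=> CP Ctot; split; last first.
    by move=> x [X CX Xx]; have [_] := CP X CX; exact.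
  apply: (indep_finitary matI) => F finF FC.
  have [->//|/set0P[y0 Fy0]] := eqVneq F set0.
  suff [X CX FX] : exists2 X, C X & F `<=` X.
    by apply: (indep_sub matI _ FX); have [] := CP X CX.
  have [Z FZ] : exists Z : {fset T}, F = [set` Z] by apply/finite_fsetP.
  have [X1 CX1 _] := FC _ Fy0.
  have FCs z : z \in enum_fset Z -> (\bigcup_(X in C) X) z.
    by move=> zZ; apply: FC; rewrite FZ.
  suff [X CX ZX] : exists2 X, C X & forall z, z \in enum_fset Z -> X z.
    by exists X => // z; rewrite FZ; exact: ZX.
  elim: (enum_fset Z) FCs => [|z s IHs] zs; first by exists X1.
  have [X CX sX] : exists2 X, C X & forall z, z \in s -> X z.
    by apply: IHs => u us; apply: zs; rewrite inE us orbT.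
  have [Y CY Yz] := zs z (mem_head _ _).
  have [XY|YX] := Ctot X Y CX CY.
    by exists Y => // u; rewrite inE => /predU1P[->//|/sX/XY].
  by exists X => // u; rewrite inE => /predU1P[->|/sX//]; exact: YX.
have [X [[IX XA] Xmax]] := Zorn_bigcup chainP.
exists X; split=> // Y IY YA XY.
apply/seteqP; split=> //; apply: contrapT => nYX.
exact: (Xmax Y).
Qed.

Lemma basis_card (T : choiceType) (I : set (set T))
    (matI : finitary_matroid I) (A X Y : set T) (n : nat) :
  basis I A X -> basis I A Y -> X #= `I_n -> Y #= `I_n.
Proof.
have fin_le (U V : set T) (k : nat) : basis I A U -> basis I A V ->
    U #= `I_k -> ~ (`I_k.+1 #<= V).
  move=> bU bV Uk /card_subP[W Wk WV].
  have IW : I W := indep_sub matI (basis_indep bV) WV.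
  have [x [Wx nUx] IxU] := indep_augment matI (basis_indep bU) IW Uk Wk.
  apply: nUx; rewrite -(basis_max bU IxU); first by left.
    by move=> y [->|]; [exact/(basis_sub bV)/WV | exact: (basis_sub bU)].
  by move=> y; right.
move=> bX bY Xn.
have [m Ym] : finite_set Y.
  apply: contrapT => /infiniteP leY; apply: (fin_le _ _ _ bX bY Xn).
  exact: card_le_trans (subset_card_le (@subsetT _ _)) leY.
have /negP := fin_le _ _ _ bX bY Xn.
rewrite (card_le_eqr Ym) card_le_II -leqNgt => mn.
have /negP := fin_le _ _ _ bY bX Ym.
rewrite (card_le_eqr Xn) card_le_II -leqNgt => nm.
by have -> : n = m by apply/eqP; rewrite eqn_leq nm mn.
Qed.

Lemma has_rank_inj (T : choiceType) (I : set (set T))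
    (matI : finitary_matroid I) (A : set T) (m n : nat) :
  has_rank I A m -> has_rank I A n -> m = n.
Proof.
move=> [X bX Xm] [Y bY Yn]; have := basis_card matI bX bY Xm.
by rewrite (card_eql Yn) => /card_eq_II.
Qed.

(* Main.v *)
Require Import Defs.
From mathcomp Require Import all_boot finmap.
From mathcomp Require Import boolp classical_sets functions cardinality.

Set Implicit Arguments.
Unset Strict Implicit.

(** The matching of [X] with a basis [Y] of [B] is a perfect matching in the
    bipartite graph where [a] in [X] is joined to [b] in [Y] when [a * b] lies
    outside [A].  An element [b] has no neighbour in [J] exactly when it lies
    in the intersection [W J] of the sets [a^-1 A], for [a] in [J], with [B].
    Since [X] and [Y] both have [n] elements, Hall's condition on [J] says that
    [Y] meets [W J] in at most [n - |J|] elements.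

    As [Y] is independent, [Y] meets [W J] in at most [rank (W J)] elements,
    so the rank condition implies Hall's condition for every [Y], and Hall's
    theorem ([hall]) gives the matchings.  Conversely a basis of [W J] extends
    to a basis [Y] of [B] ([basis_extend]); for this [Y] the bound is attained,
    and the existence of a matching gives the rank condition. *)

Local Open Scope classical_set_scope.
Local Open Scope card_scope.

(** * Hall's theorem *)

Section Hall.
Local Open Scope fset_scope.

Definition neighbours (T U : choiceType) (N : T -> {fset U}) (J : {fset T}) :
  {fset U} := \bigcup_(x <- J) N x.

Lemma neighboursP (T U : choiceType) (N : T -> {fset U}) (J : {fset T}) (y : U) :
  reflect (exists2 x, x \in J & y \in N x) (y \in neighbours N J).
Proof.
apply: (iffP (bigfcupP _ _ _ _)) => [[x /andP[xJ _] yx]|[x xJ yx]].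
  by exists x.
by exists x => //; rewrite xJ.
Qed.

Lemma neighboursU (T U : choiceType) (N : T -> {fset U}) (J K : {fset T}) :
  neighbours N (J `|` K) = neighbours N J `|` neighbours N K.
Proof.
apply/fsetP => y; rewrite in_fsetU; apply/neighboursP/orP.
  by move=> [x]; rewrite in_fsetU => /orP[] xJ yx; [left|right];
    apply/neighboursP; exists x.
by move=> [] /neighboursP[x xJ yx]; exists x; rewrite // in_fsetU xJ ?orbT.
Qed.

Lemma neighboursD (T U : choiceType) (N : T -> {fset U}) (W : {fset U})
    (J : {fset T}) :
  neighbours (fun x => N x `\` W) J = neighbours N J `\` W.
Proof.
apply/fsetP => y; rewrite in_fsetD; apply/neighboursP/andP.
  by move=> [x xJ]; rewrite in_fsetD => /andP[yW yx]; split=> //;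
    apply/neighboursP; exists x.
by move=> [yW /neighboursP[x xJ yx]]; exists x; rewrite // in_fsetD yW.
Qed.

(** This is the argument of Halmos and Vaughan.  The induction removes a
    nonempty subset [J] of [X] matched into a set [W] such that Hall's condition
    still holds between [X] without [J] and the complement of [W].  If some
    nonempty proper subset of [X] has no more neighbours than elements, it is
    such a [J], with all its neighbours as [W].  Otherwise Hall's condition
    holds with one unit to spare, so that any edge gives [J] and [W].
    The point [y0] provides values of the matching outside [X]. *)
Theorem hall (T U : choiceType) (y0 : U) (N : T -> {fset U}) (X : {fset T}) :
  (forall J, J `<=` X -> #|` J| <= #|` neighbours N J|)%N ->
  exists f : T -> U,
    {in X, forall x, f x \in N x} /\ {in X &, injective f}.
Proof.
elim/finSet_rect: X N => X IH N hallX.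
have [->|/fset0Pn[x xX]] := eqVneq X fset0.
  by exists (fun=> y0); split=> [x|x z]; rewrite in_fset0.
suff [J [W [f [[JX J0] [fN fW finj] hallJ]]]] : exists J W (f : T -> U),
    [/\ J `<=` X /\ J != fset0,
      [/\ {in J, forall x, f x \in N x}, {in J, forall x, f x \in W} &
          {in J &, injective f}] &
      forall K, K `<=` X `\` J -> (#|` K| <= #|` neighbours N K `\` W|)%N].
  have ltXJ : X `\` J `<` X.
    have /fset0Pn[z zJ] := J0.
    apply: fsub_proper_trans (fproperD1 (fsubsetP JX _ zJ)).
    by apply: fsetDS; rewrite fsub1set.
  have [|g [gN ginj]] := IH _ ltXJ (fun x => N x `\` W).
    by move=> K /hallJ; rewrite neighboursD.
  have gNW z : z \in X -> z \notin J -> (g z \in N z) && (g z \notin W).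
    move=> zX zJ; have := gN z; rewrite !in_fsetD zJ zX => /(_ isT).
    by rewrite andbC.
  exists (fun z => if z \in J then f z else g z); split.
    move=> z zX; case: ifPn => zJ; first exact: fN.
    by have /andP[] := gNW z zX zJ.
  move=> z1 z2 z1X z2X; case: ifPn => z1J; case: ifPn => z2J.
  - exact: finj.
  - by move=> e; have /andP[_] := gNW z2 z2X z2J; rewrite -e fW.
  - by move=> e; have /andP[_] := gNW z1 z1X z1J; rewrite e fW.
  - by apply: ginj; rewrite in_fsetD ?z1J ?z2J.
have [[J [ltJX J0 leJ]]|slack] := pselect (exists J,
    [/\ J `<` X, J != fset0 & #|` neighbours N J| <= #|` J|]%N).
  have JX := fproper_sub ltJX.
  have [|f [fN finj]] := IH J ltJX N.
    by move=> K KJ; apply: hallX; exact: fsubset_trans JX.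
  exists J, (neighbours N J), f; split=> //.
    by split=> // z zJ; apply/neighboursP; exists z => //; exact: fN.
  move=> K KXJ.
  have /hallX : K `|` J `<=` X.
    by rewrite fsubUset JX (fsubset_trans KXJ) // fsubsetDl.
  have KJ0 : K `&` J = fset0.
    apply/fsetP => z; rewrite in_fsetI in_fset0; apply/negbTE/negP => /andP[].
    by move=> /(fsubsetP KXJ); rewrite in_fsetD => /andP[/negP].
  rewrite neighboursU !cardfsU KJ0 cardfs0 subn0 cardfsD => leKJ.
  have := fsubset_leq_card (fsubsetIl (neighbours N K) (neighbours N J)).
  move: leKJ leJ; set k := #|` K|; set j := #|` J|.
  set p := #|` neighbours N K|; set q := #|` neighbours N J|.
  set i := #|` _ `&` _| => leKJ leJ ip.
  rewrite -(leq_add2r j) (leq_trans leKJ) // addnBAC // leq_sub2r //.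
  by rewrite leq_add2l.
have [y yx] : exists y, y \in N x.
  apply/fset0Pn; apply/eqP => Nx0.
  have := hallX [fset x]; rewrite fsub1set xX cardfs1 => /(_ isT).
  by rewrite /neighbours big_seq_fset1 Nx0 cardfs0.
exists [fset x], [fset y], (fun=> y); split.
- by rewrite fsub1set; split=> //; apply/fset0Pn; exists x; rewrite in_fset1.
- split=> [z|z _|z1 z2]; rewrite ?in_fset1 // => /eqP-> //.
  by move=> /eqP->.
- move=> K KXx; have [->|K0] := eqVneq K fset0; first by rewrite cardfs0.
  rewrite -ltnS; apply: leq_trans (_ : #|` neighbours N K| <= _)%N.
    rewrite ltnNge; apply/negP => leK; apply: slack; exists K; split=> //.
    exact: fsub_proper_trans KXx (fproperD1 xX).
  by rewrite (cardfsD1 y (neighbours N K)) -add1n leq_add2r leq_b1.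
Qed.

End Hall.

(** * Independent subsets of a set of finite rank *)

Lemma has_rank_basis (T : choiceType) (I : set (set T)) (A X : set T) (n : nat) :
  finitary_matroid I -> has_rank I A n -> basis I A X -> X #= `I_n.
Proof. by move=> matI [Z bZ Zn] bX; apply: basis_card bX Zn. Qed.

(** If [Z] had a subset of [n + 1] elements, augmentation would enlarge a basis
    of [A]. *)
Lemma indep_card_le (T : choiceType) (I : set (set T)) (A Z : set T) (n : nat) :
  finitary_matroid I -> has_rank I A n -> I Z -> Z `<=` A ->
  exists2 F : {fset T}, Z = [set` F] & (#|` F| <= n)%N.
Proof.
move=> matI [X bX Xn] IZ ZA.
have nle : ~ (`I_n.+1 #<= Z).
  move=> /card_subP[W Wn WZ].
  have IW := indep_sub matI IZ WZ.
  have [x [Wx nXx] IxX] := indep_augment matI (basis_indep bX) IW Xn Wn.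
  apply: nXx; rewrite -(basis_max bX IxX); first by left.
    by move=> y [->|]; [exact/ZA/WZ | exact: (basis_sub bX)].
  by move=> y; right.
have /finite_fsetP[F ZF] : finite_set Z.
  apply: contrapT => /infiniteP leZ; apply: nle.
  exact: card_le_trans (subset_card_le (@subsetT _ _)) leZ.
exists F => //; rewrite leqNgt; apply/negP => ltn; apply: nle.
have /card_eq_fsetP FF : #|` F| = #|` F| by [].
by rewrite ZF (card_le_eqr FF) card_le_II.
Qed.

(** An independent subset of [A] containing [Z] with the largest possible number
    of elements is maximal. *)
Lemma basis_extend (T : choiceType) (I : set (set T)) (A Z : set T) (n : nat) :
  finitary_matroid I -> has_rank I A n -> I Z -> Z `<=` A ->
  exists2 Y, basis I A Y & Z `<=` Y.
Proof.
move=> matI rA IZ ZA.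
pose P k := `[< exists F : {fset T},
  [/\ I [set` F], [set` F] `<=` A, Z `<=` [set` F] & #|` F| = k] >].
have exP : exists k, P k.
  have [F ZF _] := indep_card_le matI rA IZ ZA.
  by exists #|` F|; apply/asboolP; exists F; split; rewrite -?ZF.
have leP k : P k -> (k <= n)%N.
  move=> /asboolP[F [IF FA _ <-]].
  have [F' FF'] := indep_card_le matI rA IF FA.
  by rewrite -(set_fsetK F) FF' set_fsetK.
case: (ex_maxnP exP leP) => k /asboolP[F [IF FA ZF Fk]] kmax.
exists [set` F] => //; split=> // Y IY YA FY.
have [F' YF' _] := indep_card_le matI rA IY YA.
suff /eqP FF' : F == F' by rewrite YF' -FF'.
rewrite eqEfcard; apply/andP; split.
  by apply/fsubsetP => x xF; have := FY x xF; rewrite YF'.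
rewrite Fk; apply: kmax; apply/asboolP; exists F'; split; rewrite -?YF' //.
exact: subset_trans FY.
Qed.

Lemma in_ltranslateV (G : groupType) (a y : G) (A : set G) :
  ltranslate a^-1%g A y <-> A (a * y)%g.
Proof.
split=> [[x Ax <-]|Aay]; first by rewrite mulgA mulgV mul1g.
by exists (a * y)%g => //; rewrite mulgA mulVg mul1g.
Qed.

(** * The characterization of matchability *)

(* Intersecting with [B] outside the [\bigcap] only matters when [J] is empty:
   it makes the intersection equal to [B] in that case. *)
Theorem theorem4p3 (G : groupType) (I : set (set G)) (n : nat) (A B X : set G)
  (indG : independence_group I) (rA : has_rank I A n) (rB : has_rank I B n)
  (bX : basis I A X) :
  (forall Y : set G, basis I B Y -> matchable A X Y) <->
  (forall J : set G, J `<=` X ->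
    exists2 r : nat,
      has_rank I
        (B `&` \bigcap_(a in J) (ltranslate a^-1%g A `&` B)) r &
      (r <= n - #|` fset_set J|)%N).
Proof.
have matI := indgroup_matroid indG.
have Xn := has_rank_basis matI rA bX.
have [FX XE] : exists F : {fset G}, X = [set` F].
  by apply/finite_fsetP; exists n.
have FXn : #|` FX| = n by apply/card_eq_fsetP; rewrite -XE.
split=> [matchX J JX|rankX Y bY].
- set W := B `&` _.
  have [FJ JE] : exists F : {fset G}, J = [set` F].
    by apply/finite_fsetP; apply: sub_finite_set JX _; exists n.
  have [Z bZ] := basis_exists matI W.
  have ZB : Z `<=` B by move=> z /(basis_sub bZ)[].
  have [FZ ZE _] := indep_card_le matI rB (basis_indep bZ) ZB.
  have [Y bY ZY] := basis_extend matI rB (basis_indep bZ) ZB.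
  have [f [fY finj _] fA] := matchX Y bY.
  have Yn := has_rank_basis matI rB bY.
  have [FY YE] : exists F : {fset G}, Y = [set` F].
    by apply/finite_fsetP; exists n.
  have FYn : #|` FY| = n by apply/card_eq_fsetP; rewrite -YE.
  exists #|` FZ|; first by exists Z => //; rewrite ZE; apply/card_eq_fsetP.
  have JXs a : a \in FJ -> X a by move=> aJ; apply: JX; rewrite JE.
  (* No element of [Z] is a partner of an element [a] of [J], as [a * Z] lies
     in [A]; hence [f] maps [J] injectively into [Y] without [Z]. *)
  have fJY : ((f @` FJ) `<=` FY `\` FZ)%fset.
    apply/fsubsetP => _ /imfsetP[a /= aJ ->]; rewrite in_fsetD; apply/andP; split.
      apply/negP => faZ; have /(basis_sub bZ)[_ Wfa] : Z (f a) by rewrite ZE.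
      have Ja : J a by rewrite JE.
      have [/in_ltranslateV Afa _] := Wfa a Ja.
      exact: fA (JX _ Ja) Afa.
    by have := fY a (JXs a aJ); rewrite YE.
  have FZY : (FZ `<=` FY)%fset.
    by apply/fsubsetP => z zZ; have := ZY z; rewrite ZE YE; exact.
  have := fsubset_leq_card fJY; rewrite cardfsDS // FYn card_in_imfset /=; last first.
    by move=> a b aJ bJ; apply: finj; rewrite inE; exact: JXs.
  have := fsubset_leq_card FZY; rewrite FYn => leZn leJ.
  have leJn := leq_trans leJ (leq_subr _ _).
  by rewrite JE set_fsetK leq_subRL // addnC -leq_subRL.
- have Yn := has_rank_basis matI rB bY.
  have [FY YE] : exists F : {fset G}, Y = [set` F].
    by apply/finite_fsetP; exists n.
  have FYn : #|` FY| = n by apply/card_eq_fsetP; rewrite -YE.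
  pose N (a : G) : {fset G} := [fset b in FY | ~~ `[< A (a * b)%g >]]%fset.
  have NY J : (neighbours N J `<=` FY)%fset.
    by apply/fsubsetP => b /neighboursP[a _]; rewrite !inE => /andP[].
  have [J JX|f [fN finj]] := @hall _ _ (1%g : G) N FX.
    have [|r rW] := rankX [set` J].
      by move=> a aJ; rewrite XE; exact: (fsubsetP JX).
    (* Hall's condition for [J] is read on the complement [D], in [Y], of the
       neighbours of [J]: it is an independent subset of the intersection. *)
    set D := (FY `\` neighbours N J)%fset.
    have ID : I [set` D].
      apply: (indep_sub matI (basis_indep bY)) => b.
      by rewrite YE /= in_fsetD => /andP[].
    have DW : [set` D] `<=`
        B `&` \bigcap_(a in [set` J]) (ltranslate a^-1%g A `&` B).
      move=> b /=; rewrite in_fsetD => /andP[bN bY'].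
      have Bb : B b by apply: (basis_sub bY); rewrite YE.
      split=> // a aJ; split=> //; apply/in_ltranslateV; apply: contrapT => nA.
      move/negP: bN; apply; apply/neighboursP; exists a => //.
      by rewrite !inE bY'; apply/asboolP.
    have [F DF] := indep_card_le matI rW ID DW.
    rewrite set_fsetK -(set_fsetK F) -DF set_fsetK => leD /(leq_trans leD).
    have leJ := fsubset_leq_card JX; have leN := fsubset_leq_card (NY J).
    move: leJ leN; rewrite cardfsDS // FXn FYn => leJ leN.
    by rewrite leq_sub2lE.
  exists f; last first.
    move=> a; rewrite XE => /fN; rewrite !inE => /andP[_ /asboolP]; exact.
  have fFY : ((f @` FX) `<=` FY)%fset.
    by apply/fsubsetP => _ /imfsetP[a /= /fN + ->]; rewrite !inE => /andP[].
  have fE : (f @` FX)%fset = FY.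
    by apply/eqP; rewrite eqEfcard fFY card_in_imfset //= FXn FYn.
  split.
  + by move=> a; rewrite XE YE /= => /fN; rewrite !inE => /andP[].
  + by move=> a b; rewrite XE !inE; exact: finj.
  + by move=> b; rewrite YE /= -fE => /imfsetP[a aX ->]; exists a; rewrite ?XE.
Qed.
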